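(* Let $(A,\cdot,D,Q)$ be an admissible commutative differential algebra. For $q\in\mathbf{k}$ define a binary operation $\circ_q$ on $A$ by $$a\circ_q b:=a\cdot D(b)+q\,a\cdot Q(b)=a\cdot (D+qQ)(b),\qquad a,b\in A.$$ Then $(A,\circ_q)$ is a Novikov algebra for all $q\in\mathbf{k}$.
   Context: $\mathbf{k}$ is a field of characteristic $0$; all vector spaces and algebras are over $\mathbf{k}$ and finite-dimensional. A Novikov algebra is a vector space $A$ with a binary (bilinear) operation $\circ$ satisfying, for all $a,b,c\in A$, $(a\circ b)\circ c-a\circ(b\circ c)=(b\circ a)\circ c-b\circ(a\circ c)$ and $(a\circ b)\circ c=(a\circ c)\circ b$. A commutative differential algebra $(A,\cdot,D)$ is a commutative associative algebra $(A,\cdot)$ (not necessarily unital) with a linear map $D:A\to A$ satisfying $D(a\cdot b)=D(a)\cdot b+a\cdot D(b)$. An admissible commutative differential algebra $(A,\cdot,D,Q)$ is a commutative differential algebra $(A,\cdot,D)$ with a linear map $Q:A\to A$ satisfying $Q(a\cdot b)=Q(a)\cdot b-a\cdot D(b)$ for all $a,b\in A$. *)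

(* Defs.v *)
From mathcomp Require Import all_boot all_algebra.

Set Implicit Arguments.
Unset Strict Implicit.
Unset Printing Implicit Defensive.

Import GRing.Theory.

Local Open Scope ring_scope.

(* MathComp has no structure for algebras that may lack a unit, or whose
   product is not associative, so an algebra structure on a finite-dimensional
   space A is a bilinear operation A -> A -> A. *)

Record novikov_algebra (k : fieldType) (A : vectType k) (op : A -> A -> A) :
    Prop := NovikovAlgebra {
  novikov_bilinear : bilinear_for *:%R *:%R op;
  novikov_left_symmetric : forall a b c : A,
    op (op a b) c - op a (op b c) = op (op b a) c - op b (op a c);
  novikov_right_commutative : right_commutative op
}.

Record comm_diff_algebra (k : fieldType) (A : vectType k)
    (mul : A -> A -> A) (D : A -> A) : Prop := CommDiffAlgebra {
  cda_bilinear : bilinear_for *:%R *:%R mul;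
  cda_associative : associative mul;
  cda_commutative : commutative mul;
  cda_linear : linear D;
  cda_leibniz : forall a b : A, D (mul a b) = mul (D a) b + mul a (D b)
}.

Record admissible_comm_diff_algebra (k : fieldType) (A : vectType k)
    (mul : A -> A -> A) (D Q : A -> A) : Prop := AdmissibleCommDiffAlgebra {
  acda_comm_diff_algebra : comm_diff_algebra mul D;
  acda_linear : linear Q;
  acda_admissible : forall a b : A, Q (mul a b) = mul (Q a) b - mul a (D b)
}.

Definition op_q (k : fieldType) (A : vectType k) (mul : A -> A -> A)
    (D Q : A -> A) (q : k) (a b : A) : A :=
  mul a (D b) + q *: mul a (Q b).

(* Main.v *)
Require Import Defs.
From mathcomp Require Import all_boot all_algebra.

Import GRing.Theory.

Local Open Scope ring_scope.

(* With E = D + qQ, the Leibniz and admissibility rules combine into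
   E(ab) = E(a)b + (1 - q) a D(b). Hence the associator of a o b = a E(b) is
   (a o b) o c - a o (b o c) = -(1 - q) ab D(E(c)), symmetric in a and b, while
   (a o b) o c = a E(b) E(c) is symmetric in b and c. *)

Section Admissible.

Context (k : fieldType) (A : vectType k) (mul : A -> A -> A) (D Q : A -> A).
Hypothesis hA : admissible_comm_diff_algebra mul D Q.
Variable q : k.

Let E (b : A) : A := D b + q *: Q b.

Let hC : comm_diff_algebra mul D := acda_comm_diff_algebra hA.

Lemma mul_linearl c : linear (mul^~ c).
Proof. by case: (cda_bilinear hC) => + _; exact. Qed.

Lemma mul_linearr a : linear (mul a).
Proof. by case: (cda_bilinear hC) => _; exact. Qed.

Lemma admissible_mulDl a b c : mul (a + b) c = mul a c + mul b c.
Proof. by have := mul_linearl c 1 a b; rewrite !scale1r. Qed.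

Lemma admissible_mulDr a b c : mul a (b + c) = mul a b + mul a c.
Proof. by have := mul_linearr a 1 b c; rewrite !scale1r. Qed.

Lemma admissible_mul0r a : mul a 0 = 0.
Proof. by apply: (addIr (mul a 0)); rewrite -admissible_mulDr !add0r. Qed.

Lemma admissible_mulZr x a b : mul a (x *: b) = x *: mul a b.
Proof.
by have := mul_linearr a x b 0; rewrite admissible_mul0r !addr0.
Qed.

Lemma admissible_mulZl x a b : mul (x *: a) b = x *: mul a b.
Proof.
by rewrite (cda_commutative hC) admissible_mulZr (cda_commutative hC).
Qed.

(** The scalar [q] moves into the second factor, so that iterated products can be handled through
    the single map [E]. *)
Lemma op_qE a b : op_q mul D Q q a b = mul a (E b).
Proof. by rewrite /op_q /E admissible_mulDr admissible_mulZr. Qed.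

(** Gives linearity of [op_q] in its second argument. *)
Lemma deformed_derivation_linear : linear E.
Proof.
move=> x u v; rewrite /E (cda_linear hC) (acda_linear hA) !scalerDr !scalerA.
by rewrite (mulrC x) addrACA.
Qed.

(** The term [mul a (D b)] has coefficient 1 from the Leibniz rule for [D] and [- q] from the
    admissibility rule for [q *: Q]; the other terms assemble into [mul (E a) b]. *)
Lemma deformed_derivationM a b :
  E (mul a b) = mul (E a) b + (1 - q) *: mul a (D b).
Proof.
rewrite /E (cda_leibniz hC) (acda_admissible hA) admissible_mulDl.
rewrite admissible_mulZl scalerBr scalerBl scale1r -!addrA; congr (_ + _).
by rewrite [RHS]addrCA.
Qed.

Lemma op_q_associator a b c :
  op_q mul D Q q (op_q mul D Q q a b) c - op_q mul D Q q a (op_q mul D Q q b c)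
  = - ((1 - q) *: mul (mul a b) (D (E c))).
Proof.
(* The product rule is applied to [b] and [E c]; up to associativity its first term reproduces the
   product bracketed to the left, and cancels. *)
rewrite !op_qE deformed_derivationM admissible_mulDr admissible_mulZr.
by rewrite !(cda_associative hC) opprD addNKr.
Qed.

Lemma op_q_novikov : novikov_algebra (op_q mul D Q q).
Proof.
split.
- split=> [c x u v | a x u v] /=; rewrite !op_qE; first exact: mul_linearl.
  by rewrite deformed_derivation_linear; apply: mul_linearr.
- by move=> a b c; rewrite !op_q_associator (cda_commutative hC a).
(* Associativity brackets [E b] with [E c], so that commutativity can swap them. *)
- move=> a b c; rewrite !op_qE -!(cda_associative hC).
  by rewrite (cda_commutative hC (E b)).
Qed.

End Admissible.

Theorem proposition2p8 (k : fieldType) (k_char0 : [pchar k] =i pred0)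
    (A : vectType k) (mul : A -> A -> A) (D Q : A -> A)
    (hA : admissible_comm_diff_algebra mul D Q) (q : k) :
  (forall a b : A, op_q mul D Q q a b = mul a (D b + q *: Q b)) /\
  novikov_algebra (op_q mul D Q q).
Proof. by split; [exact: op_qE | exact: op_q_novikov]. Qed.
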